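(* Each weakly semiregular compact semitopological group $G$ is a topological group.
   Context: A semitopological group is a group $G$ endowed with a topology such that the multiplication map $G\times G\to G$, $(x,y)\mapsto xy$, is separately continuous (i.e. all left and right translations are continuous). A topological group is a group with a topology for which the multiplication $G\times G\to G$ is (jointly) continuous and the inversion $x\mapsto x^{-1}$ is continuous. A topological space $X$ is weakly semiregular if it has a base consisting of regular open sets, i.e. sets $U$ with $U=\operatorname{int}\overline{U}$. Compact means that every open cover has a finite subcover. No separation axioms are assumed unless stated; in particular, compact spaces and topological groups are not assumed to be Hausdorff. *)

(* Defs.v *)
From HB Require Import structures.
From mathcomp Require Import all_boot.
From mathcomp Require Import all_classical topology.

Set Implicit Arguments.
Unset Strict Implicit.
Unset Printing Implicit Defensive.

Local Open Scope classical_set_scope.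
Local Open Scope group_scope.

(* A group (possibly infinite) endowed with a topology, with no compatibility
   between the two; analogue of [PreTopologicalNmodule]. *)
#[short(type="preTopologicalGroupType")]
HB.structure Definition PreTopologicalGroup :=
  {G of Topological G & Group G}.

Definition semitopological_group (G : preTopologicalGroupType) : Prop :=
  (forall a : G, continuous (fun x : G => a * x)) /\
  (forall a : G, continuous (fun x : G => x * a)).

Definition topological_group (G : preTopologicalGroupType) : Prop :=
  continuous (fun xy : G * G => xy.1 * xy.2) /\
  continuous (fun x : G => x^-1).

Definition weakly_semiregular (T : topologicalType) : Prop :=
  exists2 B : set (set T), basis B & forall U, B U -> regopen U.

(* Main.v *)
Require Import Defs.
From HB Require Import structures.
From mathcomp Require Import all_boot.
From mathcomp Require Import all_classical topology.

Local Open Scope classical_set_scope.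

(** The proof has two independent halves.

    The first half shows that [G] is regular.  Write [close x y] when every
    neighbourhood of [x] meets every neighbourhood of [y].  Closeness is
    preserved by translations, so if [y] is close to [x] and [U] is an open
    neighbourhood of [x], then the right translate [U * (x^-1 * y)] is an open
    neighbourhood of [y] each point of which is close to a point of [U]; hence
    this translate lies in the closure of [U].  If [U] is regular open, then
    [y] is in [U].  So in a weakly semiregular semitopological group two close
    points have the same neighbourhoods ([close_nbhs_mem]), and a compact space
    with this property is regular ([compact_regular_space]).

    The second half is a version of Ellis' theorem for regular compact spaces
    that need not be Hausdorff.  A double limit argument
    ([separately_continuous_quasi]) shows that a separately continuous function
    on a product of two compact spaces, with values in a regular space, is
    jointly continuous up to moving the first variable: arbitrarily near [x0]
    there is a nonempty open set [U'], and around [y0] a neighbourhood [V'],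
    such that [f] maps [U' * V'] near [f x0 y0].  In a group the defect is
    repaired by translating: if [x] tends to [1] and [y] tends to [g], then
    [u * x] is in [U'] for any [u] in [U'], so [u * x * y] is near [g]; as [u]
    can be taken as near [1] as desired, every limit [z] of [x * y] is close to
    [g] ([mul_limit_close]).  With compactness and regularity this gives the
    joint continuity of the product, and, taking [y = x^-1], so that [z = 1],
    the continuity of the inverse. *)

(** * Compact spaces *)

Section CompactSpaces.
Context {T : topologicalType}.

Lemma cover_compact_setT_compact :
  cover_compact [set: T] -> compact [set: T].
Proof.
move=> cT F PF FT; have [x0 _] := filter_ex FT.
(* The equivalence of the two notions of compactness requires a base point. *)
pose pT : ptopologicalType := HB.pack_for ptopologicalType T
  (isPointed.Build T x0).
have cpT : compact [set: pT] by rewrite compact_cover.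
exact: cpT.
Qed.

Lemma compact_cluster_mem {F : set_system T} {O : set T} : compact [set: T] ->
  Filter F -> open O -> cluster F `<=` O -> F O.
Proof.
move=> cT FF oO FO; apply: contrapT => nFO.
have PF : ProperFilter (within (~` O) F).
  split; last exact: within_filter.
  rewrite /within /= => F0; apply: nFO.
  by apply: filterS F0 => x /= h; apply: contrapT => /h.
have [|p [_ cp]] := cT (within (~` O) F) PF; first exact: filterT.
have Op : O p.
  apply: FO => A B FA; apply: cp; apply: filterS FA => x Ax _; exact: Ax.
have wO : within (~` O) F (~` O) by apply: withinT.
by have [x []] := cp _ _ wO (open_nbhs_nbhs (conj oO Op)).
Qed.

Lemma compact_seq_cluster (u : nat -> T) : compact [set: T] ->
  exists p : T, forall B, nbhs p B -> forall N, exists2 n, (N <= n)%N & B (u n).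
Proof.
move=> cT; have [|p [_ cp]] := cT (u n @[n --> \oo]) _.
  exact: filterT.
exists p => B pB N.
have FN : (u n @[n --> \oo]) [set u n | n in [set n | (N <= n)%N]].
  by exists N => // n /= Nn; exists n.
by have [_ [[n Nn <-] Bun]] := cp _ _ FN pB; exists n.
Qed.

(** The points that lie in the closure of each neighbourhood of [x] are the
    points close to [x]; by hypothesis they lie in each open set around [x],
    and compactness passes from the intersection to one of the closures. *)
Lemma compact_regular_space : compact [set: T] ->
  (forall (x y : T) (O : set T), close x y -> nbhs x O -> O y) ->
  regular_space T.
Proof.
move=> cT R1 x A xA.
have FF : Filter (filter_from (nbhs x) closure).
  apply: filter_from_filter; first by exists setT; exact: filterT.
  move=> U V xU xV; exists (U `&` V); first exact: filterI.
  exact: closureI.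
suff FA : filter_from (nbhs x) closure A°.
  by apply: filterS FA; exact: interior_subset.
apply: compact_cluster_mem => // [|p cp]; first exact: open_interior.
apply: (R1 x); last exact: nbhs_interior.
rewrite closeEnbhs => U B xU pB.
have [q [Uq Bq]] : closure U `&` B° !=set0.
  by apply: cp; [exists U | exact: nbhs_interior].
have [r [Ur Br]] := Uq _ Bq; by exists r.
Qed.

End CompactSpaces.

(** * Joint continuity from separate continuity *)

(** If this fails, dependent choice gives points [a n] in shrinking open sets
    and [y n] in shrinking neighbourhoods of [y0] such that [f (a n) (y k)] is
    in [W] when [n < k] and outside the closure of [W1] when [k < n], where [W]
    is a neighbourhood of [f x0 y0] with closure in [W1].  For cluster points
    [a] and [y] of the two sequences, the two iterated limits locate [f a y]
    both inside and outside [W1]. *)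
Lemma separately_continuous_quasi {X Y Z : topologicalType} (f : X -> Y -> Z)
    (x0 : X) (y0 : Y) (U : set X) (O : set Z) :
  compact [set: X] -> compact [set: Y] -> regular_space Z ->
  (forall x, continuous (f x)) -> (forall y, continuous (f^~ y)) ->
  nbhs x0 U -> nbhs (f x0 y0) O ->
  exists U' V', [/\ open U', U' !=set0, U' `<=` U, nbhs y0 V' &
    forall x y, U' x -> V' y -> O (f x y)].
Proof.
move=> cX cY rZ fc1 fc2 x0U fO.
have [W1' W1'n W1O] := rZ _ _ fO.
pose W1 := W1'°.
have [W' W'n WW1] : filter_from (nbhs (f x0 y0)) closure W1.
  by apply: rZ; exact: nbhs_interior.
pose W := W'°.
have oW : open W by exact: open_interior.
have clWW1 : closure W `<=` W1.
  by apply: subset_trans WW1; apply: closureS; exact: interior_subset.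
have clW1O : closure W1 `<=` O.
  by apply: subset_trans W1O; apply: closureS; exact: interior_subset.
apply: contrapT => bad.
(* A state is (A, V, a, y): the current open set and neighbourhood of [y0],
   followed by the points chosen from the preceding ones. *)
pose good (s : set X * set Y * X * Y) :=
  let: (A, V, _, _) := s in
  [/\ open A, A !=set0, A `<=` U, (forall x, A x -> W (f x y0)) & nbhs y0 V].
pose next (s t : set X * set Y * X * Y) :=
  let: (A, V, _, _) := s in let: (A', V', a, y) := t in
  [/\ A a, V y, A' = A `&` [set x | ~ closure W1 (f x y)] &
      V' = V `&` [set z | W (f a z)]].
have step (s : {s | good s}) : {t : {s | good s} | next (sval s) (sval t)}.
  apply: cid; case: s => [[[[A V] a0] z0] [oA A0 AU AW yV]].
  have [a [y [Aa Vy nO]]] : exists a y, [/\ A a, V y & ~ O (f a y)].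
    apply: contrapT => h; apply: bad; exists A, V; split=> // x y Ax Vy.
    by apply: contrapT => nO; apply: h; exists x, y.
  pose A' := A `&` [set x | ~ closure W1 (f x y)].
  pose V' := V `&` [set z | W (f a z)].
  have g : good (A', V', a, y).
    split.
    - apply: openI => //.
      apply: (@open_comp _ _ (f^~ y) (~` closure W1)) => [x _|].
        exact: fc2.
      by apply: closed_openC; exact: closed_closure.
    - by exists a; split=> // /clW1O.
    - by move=> x [/AU].
    - by move=> x [/AW].
    - apply: filterI => //; apply: (fc1 a).
      by apply: open_nbhs_nbhs; split=> //; exact: AW.
  by exists (exist _ (A', V', a, y) g).
have g0 : good (U° `&` [set x | W (f x y0)], setT, x0, y0).
  split.
  - apply: openI; first exact: open_interior.
    by apply: (@open_comp _ _ (f^~ y0) W) => // x _; exact: fc2.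
  - by exists x0; split; [exact: x0U | exact: W'n].
  - by move=> x [/interior_subset].
  - by move=> x [].
  - exact: filterT.
have [st [_ stS]] := dependent_choice step (exist _ _ g0).
(* The points chosen from the [n]-th sets are recorded in state [n.+1]; those of
   the initial state are dummies. *)
pose A n := (sval (st n)).1.1.1; pose V n := (sval (st n)).1.1.2.
pose a n := (sval (st n.+1)).1.2; pose y n := (sval (st n.+1)).2.
have nxt n : [/\ A n (a n), V n (y n),
    A n.+1 = A n `&` [set x | ~ closure W1 (f x (y n))] &
    V n.+1 = V n `&` [set z | W (f (a n) z)]].
  rewrite /A /V /a /y; move: (stS n).
  by case: (sval (st n)) => [[[? ?] ?] ?]; case: (sval (st n.+1)) => [[[? ?] ?] ?].
have Adec n m : (n <= m)%N -> A m `<=` A n.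
  elim: m => [|m IH]; first by rewrite leqn0 => /eqP ->.
  rewrite leq_eqVlt => /orP[/eqP -> //|/IH]; apply: subset_trans.
  by have [_ _ -> _] := nxt m; move=> x [].
have Vdec n m : (n <= m)%N -> V m `<=` V n.
  elim: m => [|m IH]; first by rewrite leqn0 => /eqP ->.
  rewrite leq_eqVlt => /orP[/eqP -> //|/IH]; apply: subset_trans.
  by have [_ _ _ ->] := nxt m; move=> x [].
have fin n k : (n < k)%N -> W (f (a n) (y k)).
  move=> nk; have [_ Vy _ _] := nxt k; have := Vdec _ _ nk _ Vy.
  by have [_ _ _ ->] := nxt n => -[].
have fout n k : (k < n)%N -> ~ closure W1 (f (a n) (y k)).
  move=> kn; have [Aa _ _ _] := nxt n; have := Adec _ _ kn _ Aa.
  by have [_ _ -> _] := nxt k => -[].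
have [aoo aP] := compact_seq_cluster a cX.
have [yoo yP] := compact_seq_cluster y cY.
have clW n : closure W (f (a n) yoo).
  move=> B fB; have [k nk Bk] := yP _ (fc1 (a n) yoo B fB) n.+1.
  by exists (f (a n) (y k)); split=> //; exact: fin.
have W1oo : W1 (f aoo yoo).
  apply: clWW1; apply: closed_closure => B fB.
  have [n _ Bn] := aP _ (fc2 yoo aoo B fB) 0%N.
  by exists (f (a n) yoo); split.
have /fc1 W1n : nbhs (f aoo yoo) W1.
  by apply: open_nbhs_nbhs; split=> //; exact: open_interior.
have [k _ W1k] := yP _ W1n 0%N.
have /fc2 W1n' : nbhs (f aoo (y k)) W1.
  by apply: open_nbhs_nbhs; split=> //; exact: open_interior.
have [n kn W1nk] := aP _ W1n' k.+1.
by apply: (fout _ _ kn); apply: subset_closure.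
Qed.

(** * Semitopological groups *)

Section SemitopologicalGroups.
Context {G : preTopologicalGroupType}.
Hypothesis hG : semitopological_group G.
Local Open Scope group_scope.

Let lmul_continuous (a : G) : continuous (fun x : G => a * x).
Proof. exact: hG.1. Qed.

Let rmul_continuous (a : G) : continuous (fun x : G => x * a).
Proof. exact: hG.2. Qed.

Lemma close_mulgl (a x y : G) : close x y -> close (a * x) (a * y).
Proof.
rewrite !closeEnbhs => xy A B axA ayB.
have [z [/= Az Bz]] := xy _ _ (lmul_continuous a x A axA) (lmul_continuous a y B ayB).
by exists (a * z).
Qed.

(** The point [t * (y^-1 * x)] is the inverse image of [t] under the right
    translation that sends [x] to [y]; it is close to [t]. *)
Lemma close_nbhs_mem (x y : G) (O : set G) : weakly_semiregular G ->
  close x y -> nbhs x O -> O y.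
Proof.
move=> [B [Bo Bb] Breg] xy xO.
have [U [BU Ux] UO] := Bb _ _ xO.
apply: UO; rewrite /= -(Breg _ BU).
have yU : nbhs y [set t | U (t * (y^-1 * x))].
  apply: rmul_continuous; rewrite mulVKg.
  by apply: open_nbhs_nbhs; split=> //; exact: Bo.
apply: filterS yU => t /= Ut.
have : close (t * (y^-1 * x)) t.
  by have := close_mulgl (t * y^-1) x y xy; rewrite -!mulgA mulVg mulg1.
rewrite closeEnbhs => ut C tC; apply: ut => //.
by apply: open_nbhs_nbhs; split=> //; exact: Bo.
Qed.

Hypothesis G_compact : compact [set: G].
Hypothesis G_regular : regular_space G.

(** Here [z] is a limit of products [x * y] along some net with [x] tending to
    [1] and [y] tending to [g].  Along it, [u * (x * y)] tends to [u * z], which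
    is near [z] for [u] near [1], while [(u * x) * y] stays near [g] when [u]
    is taken in the open set where the product is jointly controlled. *)
Lemma mul_limit_close (g z : G) :
  (forall A B C, nbhs 1 A -> nbhs g B -> nbhs z C ->
     exists x y : G, [/\ A x, B y & C (x * y)]) ->
  close g z.
Proof.
move=> lim; rewrite closeEnbhs => W C gW zC.
have UC : nbhs 1 [set u : G | C° (u * z)].
  by apply: rmul_continuous; rewrite mul1g; exact: nbhs_interior.
have [|U' [V' [oU' [u U'u] U'C gV' U'V']]] :=
    @separately_continuous_quasi _ _ _ (fun x y : G => x * y) 1 g _ W
      G_compact G_compact G_regular lmul_continuous rmul_continuous UC.
  by rewrite mul1g.
have uU' : nbhs 1 [set x : G | U' (u * x)].
  by apply: lmul_continuous; rewrite mulg1; exact: open_nbhs_nbhs.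
have [x [y [/= U'ux V'y Cuxy]]] :=
  lim _ _ _ uU' gV' (lmul_continuous u z _ (U'C _ U'u)).
exists (u * (x * y)); split=> //.
by rewrite mulgA; exact: U'V'.
Qed.

Lemma regular_close_mem (x y : G) (O : set G) : close x y -> nbhs x O -> O y.
Proof.
rewrite closeEnbhs => xy /G_regular[A xA]; apply => B yB; exact: xy.
Qed.

Lemma compact_regular_mul_continuous :
  continuous (fun xy : G * G => xy.1 * xy.2).
Proof.
have mul1 (b : G) : xy.1 * xy.2 @[xy --> ((1 : G), b)] --> b.
  move=> O bO.
  suff FO : (xy.1 * xy.2 @[xy --> ((1 : G), b)]) O°.
    by apply: filterS FO; exact: interior_subset.
  apply: compact_cluster_mem => // [|z cz]; first exact: open_interior.
  apply: (@regular_close_mem b); last exact: nbhs_interior.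
  apply: mul_limit_close => A B C oA bB zC.
  have FAB : (xy.1 * xy.2 @[xy --> ((1 : G), b)])
      [set xy.1 * xy.2 | xy in A `*` B].
    by exists (A, B) => //= xy ABxy; exists xy.
  by have [_ [[[x y] [/= Ax By] <-] Cxy]] := cz _ _ FAB zC; exists x, y.
move=> [a b] O abO.
have [[A B] [/= oA bB] ABO] := mul1 b _ (lmul_continuous a b O abO).
exists ([set x | A (a^-1 * x)], B) => /=.
  by split=> //; apply: lmul_continuous; rewrite mulVg.
move=> [x y] [/= Ax By]; have := ABO (a^-1 * x, y) (conj Ax By).
by rewrite /= !mulgA mulgV mul1g.
Qed.

Lemma compact_regular_inv_continuous : continuous (fun x : G => x^-1).
Proof.
have inv1 : x^-1 @[x --> (1 : G)] --> (1 : G).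
  move=> O oO.
  suff FO : (x^-1 @[x --> (1 : G)]) O°.
    by apply: filterS FO; exact: interior_subset.
  apply: compact_cluster_mem => // [|s cs]; first exact: open_interior.
  apply: (@regular_close_mem 1); last exact: nbhs_interior.
  apply: close_sym; apply: mul_limit_close => A B C oA sB oC.
  have FA : (x^-1 @[x --> (1 : G)]) [set x^-1 | x in A].
    by apply: filterS oA => x Ax; exists x.
  have [_ [[x Ax <-] Bx]] := cs _ _ FA sB; exists x, x^-1; split=> //.
  by rewrite mulgV; exact: nbhs_singleton oC.
move=> a O aO.
have O1 : nbhs 1 [set y : G | O (y * a^-1)].
  by apply: rmul_continuous; rewrite mul1g.
have /inv1 O1' := O1.
have : nbhs a [set x | O ((a^-1 * x)^-1 * a^-1)].
  by apply: (lmul_continuous a^-1 a [set y | O (y^-1 * a^-1)]); rewrite mulVg.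
by apply: filterS => x /=; rewrite invgM invgK mulgK.
Qed.

End SemitopologicalGroups.

Theorem proposition3 (G : preTopologicalGroupType)
    (hG : semitopological_group G)
    (hreg : weakly_semiregular G)
    (hcomp : cover_compact [set: G]) :
  topological_group G.
Proof.
have cG := cover_compact_setT_compact hcomp.
have rG : regular_space G.
  by apply: compact_regular_space => // x y O; exact: close_nbhs_mem.
split; first exact: compact_regular_mul_continuous.
exact: compact_regular_inv_continuous.
Qed.
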